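(* Let $n\ge2$, let $\tau,\lambda\in\mathbb R_{>0}$ with $\tau-\lambda>0$, and let $$\Delta=\Big\{(x_1,\dots,x_n)\in\mathbb R^n:\ \sum_{i=1}^nx_i\le\tau,\ 0\le x_i\ (i=1,\dots,n),\ x_n\le\lambda\Big\}$$ be the polytope obtained by truncating the standard $n$-simplex $S_n(\tau)=\{x\in\mathbb R^n:\sum x_i\le\tau,\ x_i\ge0\}$ by a horizontal hyperplane. If $(\Delta,\mathbf b)$ is a mass linear pair, with $\langle\mathrm{Cm}(\Delta(k)),\mathbf b\rangle=\sum_{j=1}^{n+2}R_jk_j+C$ for all $k\in\mathcal C_\Delta$ ($R_j$, $C$ constants), then $\sum_{j=1}^{n+2}R_j=0$.
   Context: With $e_1,\dots,e_n$ the standard basis of $\mathbb R^n$, $\Delta$ has outward conormals $\mathbf n_j=-e_j$ ($j=1,\dots,n$), $\mathbf n_{n+1}=\sum_{i=1}^ne_i$, $\mathbf n_{n+2}=e_n$. For $k\in\mathbb R^{n+2}$ put $\Delta(k)=\bigcap_{j=1}^{n+2}\{x:\langle x,\mathbf n_j\rangle\le k_j\}$, with facets $F_j(k)$ contained in $\langle x,\mathbf n_j\rangle=k_j$; thus $\Delta=\Delta(0,\dots,0,\tau,\lambda)$. The chamber $\mathcal C_\Delta$ is the set of $k\in\mathbb R^{n+2}$ such that $\Delta(k)$ is analogous to $\Delta$: for every $J\subset\{1,\dots,n+2\}$ the facets $F_j(k)$, $j\in J$, of $\Delta(k)$ have nonempty common intersection iff the corresponding facets of $\Delta$ do. $\mathrm{Cm}(\Delta(k))$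 is the center of mass of $\Delta(k)$. For $\mathbf b\in\mathbb R^n$ the pair $(\Delta,\mathbf b)$ is mass linear if constants $R_j,C\in\mathbb R$ with the displayed property exist. *)

(* Defs.v *)
From HB Require Import structures.
From mathcomp Require Import all_boot all_order all_algebra.
From mathcomp Require Import all_classical all_reals all_analysis.

Set Implicit Arguments.
Unset Strict Implicit.
Unset Printing Implicit Defensive.

Import Order.TTheory GRing.Theory Num.Theory.
Import numFieldNormedType.Exports.

Local Open Scope classical_set_scope.
Local Open Scope ring_scope.

(* The library has no n-dimensional Lebesgue measure.  We give 'rV[R]_n the
   product sigma-algebra and build the measure on it by iterated products. *)

Definition measure_rV_display : measure_display -> measure_display.
Proof. exact. Qed.

Section measurable_rV.
Context {d} {T : sigmaRingType d} (n : nat).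

Let coord : 'I_n -> 'rV[T]_n -> T := fun i x => x 0 i.

Let rV_set0 : g_sigma_preimage coord set0.
Proof. exact: sigma_algebra0. Qed.

Let rV_setC A : g_sigma_preimage coord A -> g_sigma_preimage coord (~` A).
Proof. exact: sigma_algebraC. Qed.

Let rV_bigcup (F : _^nat) : (forall i, g_sigma_preimage coord (F i)) ->
  g_sigma_preimage coord (\bigcup_i (F i)).
Proof. exact: sigma_algebra_bigcup. Qed.

HB.instance Definition _ := @isMeasurable.Build (measure_rV_display d)
  'rV[T]_n (g_sigma_preimage coord) rV_set0 rV_setC rV_bigcup.

End measurable_rV.

Lemma measurable_rV_coord d (T : sigmaRingType d) n (i : 'I_n) :
  measurable_fun [set: 'rV[T]_n] (fun x : 'rV[T]_n => x 0 i).
Proof.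
move=> _ Y mY; rewrite setTI; apply: sub_sigma_algebra => /=.
rewrite -bigcup_seq/=; exists i => /=; first by rewrite mem_index_enum.
by exists Y => //; rewrite setTI.
Qed.

Lemma measurable_rV_box d (T : measurableType d) n (A : 'I_n -> set T) :
    (forall i, measurable (A i)) ->
  measurable [set x : 'rV[T]_n | forall i, A i (x 0 i)].
Proof.
move=> mA; rewrite (_ : [set _ | _] =
  \bigcap_(i in [set: 'I_n]) ((fun x : 'rV[T]_n => x 0 i) @^-1` A i)).
  apply: fin_bigcap_measurable => // i _.
  by rewrite -[X in measurable X]setTI; exact: measurable_rV_coord.
by apply/seteqP; split => x /= H i => [_|]; exact: H.
Qed.

Lemma measurable_fun_rVP d1 d2 (T1 : measurableType d1)
    (T2 : measurableType d2) n (f : T1 -> 'rV[T2]_n) :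
  measurable_fun [set: T1] f <->
  forall i, measurable_fun [set: T1] (fun x => f x 0 i).
Proof.
split=> [mf i|mf].
  apply: (@measurableT_comp _ _ _ _ _ _ (fun x : 'rV[T2]_n => x 0 i)) => //.
  exact: measurable_rV_coord.
apply: (@measurability _ _ _ _ _ _
  (\big[setU/set0]_(i < n) preimage_set_system setT
     (fun x : 'rV[T2]_n => x 0 i) measurable)) => //.
move=> _ [A + <-]; rewrite -bigcup_seq => -[i _ [B mB <-]].
by rewrite !setTI; have := mf i measurableT B mB; rewrite setTI.
Qed.

Definition cons_rV (T : Type) n (p : T * 'rV[T]_n) : 'rV[T]_n.+1 :=
  row_mx (const_mx p.1 : 'rV_1) p.2.

Lemma cons_rV0 (T : Type) n (p : T * 'rV[T]_n) : cons_rV p 0 ord0 = p.1.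
Proof.
by rewrite /cons_rV mxE; case: splitP => [j _|j //]; rewrite mxE.
Qed.

Lemma cons_rVS (T : Type) n (p : T * 'rV[T]_n) (i : 'I_n) :
  cons_rV p 0 (lift ord0 i) = p.2 0 i.
Proof.
rewrite /cons_rV mxE; case: splitP => [[[]]//|j [ij]].
by congr (_ _ _); exact/val_inj.
Qed.

Lemma measurable_cons_rV d (T : measurableType d) n :
  measurable_fun [set: T * 'rV[T]_n] (@cons_rV T n).
Proof.
apply/measurable_fun_rVP => i; case: (unliftP ord0 i) => [j|] ->.
  rewrite (_ : (fun _ => _) = (fun x : 'rV[T]_n => x 0 j) \o snd).
    by apply: measurableT_comp => //; exact: measurable_rV_coord.
  by apply/funext => p; rewrite /= cons_rVS.
by rewrite (_ : (fun _ => _) = fst)//; apply/funext => p; rewrite cons_rV0.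
Qed.

Section lebesgue_cons.
Local Open Scope ereal_scope.
Context {R : realType} (n : nat).
Variable mu : {sigma_finite_measure set 'rV[R]_n -> \bar R}.

(* The push-forward of lebesgue_measure \x mu under (a, x) |-> (a, x_1, ..., x_n). *)
Definition lebesgue_cons : set 'rV[R]_n.+1 -> \bar R :=
  pushforward (@lebesgue_measure R \x mu) (@cons_rV R n).

Let mcons := @measurable_cons_rV _ R n.

Let lebesgue_cons0 : lebesgue_cons set0 = 0.
Proof. by rewrite /lebesgue_cons /pushforward preimage_set0 measure0. Qed.

Let lebesgue_cons_ge0 A : 0 <= lebesgue_cons A.
Proof. exact: measure_ge0. Qed.

Let lebesgue_cons_sigma_additive : semi_sigma_additive lebesgue_cons.
Proof.
move=> F mF tF mUF.
rewrite /lebesgue_cons /pushforward preimage_bigcup.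
apply: measure_semi_sigma_additive.
- by move=> i; rewrite -[X in measurable X]setTI; exact: mcons.
- apply/trivIsetP => /= i j _ _ ij; rewrite -preimage_setI.
  by move/trivIsetP : tF => /(_ _ _ _ _ ij) ->//; rewrite preimage_set0.
- by rewrite -preimage_bigcup -[X in measurable X]setTI; exact: mcons.
Qed.

HB.instance Definition _ := isMeasure.Build _ _ _ lebesgue_cons
  lebesgue_cons0 lebesgue_cons_ge0 lebesgue_cons_sigma_additive.

Lemma lebesgue_cons_box (A : 'I_n.+1 -> set R) :
    (forall i, measurable (A i)) ->
  lebesgue_cons [set x : 'rV[R]_n.+1 | forall i, A i (x 0%R i)] =
  lebesgue_measure (A ord0) *
  mu [set x : 'rV[R]_n | forall i, A (lift ord0 i) (x 0%R i)].
Proof.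
move=> mA; rewrite /lebesgue_cons /pushforward -product_measure1E//.
  congr (_ _); apply/seteqP; split => [[a x]/= H|[a x]/= [Aa Ax] i].
    split; first by have := H ord0; rewrite cons_rV0.
    by move=> i; have := H (lift ord0 i); rewrite cons_rVS.
  by case: (unliftP ord0 i) => [j|] ->; rewrite ?cons_rVS ?cons_rV0.
  exact: mA.
exact: (@measurable_rV_box _ R n (fun i => A (lift ord0 i)) (fun i => mA _)).
Qed.

Let lebesgue_cons_sigma_finite : sigma_finite setT lebesgue_cons.
Proof.
have /sigma_finiteP[F [TF ndF Foo]] := sigma_finiteT (@lebesgue_measure R).
have /sigma_finiteP[G [TG ndG Goo]] := sigma_finiteT mu.
pose hd := fun x : 'rV[R]_n.+1 => x 0%R ord0.
pose tl := fun x : 'rV[R]_n.+1 => \row_i x 0%R (lift ord0 i).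
have mhd : measurable_fun setT hd by exact: measurable_rV_coord.
have mtl : measurable_fun setT tl.
  apply/measurable_fun_rVP => i; rewrite (_ : (fun _ => _) =
    fun x : 'rV[R]_n.+1 => x 0%R (lift ord0 i)); first exact: measurable_rV_coord.
  by apply/funext => x; rewrite mxE.
exists (fun k => hd @^-1` F k `&` tl @^-1` G k).
  apply/seteqP; split => // x _.
  have [i _ Fi] : (\bigcup_k F k) (hd x) by rewrite -TF.
  have [j _ Gj] : (\bigcup_k G k) (tl x) by rewrite -TG.
  exists (maxn i j) => //; split => /=.
    by move: Fi; exact/subsetPset/ndF/leq_maxl.
  by move: Gj; exact/subsetPset/ndG/leq_maxr.
move=> k; have [mF Fk] := Foo k; have [mG Gk] := Goo k; split.
  by apply: measurableI; rewrite -[X in measurable X]setTI; [exact: mhd|exact: mtl].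
rewrite /lebesgue_cons /pushforward (_ : _ @^-1` _ = F k `*` G k).
  by rewrite product_measure1E// lte_mul_pinfty// ge0_fin_numE.
have hdE p : hd (cons_rV p) = p.1 by rewrite /hd cons_rV0.
have tlE p : tl (cons_rV p) = p.2.
  by apply/rowP => i; rewrite /tl mxE cons_rVS.
by apply/seteqP; split => -[a x] /=; rewrite hdE tlE.
Qed.

HB.instance Definition _ := Measure_isSigmaFinite.Build _ _ _ lebesgue_cons
  lebesgue_cons_sigma_finite.

End lebesgue_cons.

Fixpoint lebesgue_rV (R : realType) n :
    {sigma_finite_measure set 'rV[R]_n -> \bar R} :=
  match n with
  | 0 => \d_(0 : 'rV[R]_0)
  | m.+1 => lebesgue_cons (lebesgue_rV R m)
  end.

Lemma lebesgue_rV_box (R : realType) n (A : 'I_n -> set R) :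
    (forall i, measurable (A i)) ->
  lebesgue_rV R n [set x | forall i, A i (x 0 i)] =
  (\prod_(i < n) lebesgue_measure (A i))%E.
Proof.
elim: n A => [|n IH] A mA /=.
  by rewrite big_ord0 diracE mem_set// => -[].
rewrite lebesgue_cons_box// big_ord_recl; congr (_ * _)%E.
exact: (IH (fun i => A (lift ord0 i)) (fun i => mA _)).
Qed.

Section polytopes.
Context {R : realType} (n : nat).
Implicit Types (x y b : 'rV[R]_n).

Definition dot x y : R := \sum_(i < n) x 0 i * y 0 i.

Definition center_of_mass (D : set 'rV[R]_n) : 'rV[R]_n :=
  \row_i ((\int[lebesgue_rV R n]_(x in D) x 0 i) / fine (lebesgue_rV R n D)).

Variables (N : nat) (nu : 'I_N -> 'rV[R]_n).
Implicit Types (k : 'rV[R]_N) (J : {set 'I_N}).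

Definition polyhedron k : set 'rV[R]_n :=
  [set x | forall j, dot x (nu j) <= k 0 j].

(* For arbitrary k this face may have codimension > 1.  This does not affect
   the chamber of truncated_simplex below: in the pattern of intersections of
   its facets, all these faces are facets. *)
Definition facet k (j : 'I_N) : set 'rV[R]_n :=
  polyhedron k `&` [set x | dot x (nu j) = k 0 j].

Definition analogous k k' : Prop :=
  forall J, (\bigcap_(j in [set` J]) facet k j !=set0) <->
            (\bigcap_(j in [set` J]) facet k' j !=set0).

Definition chamber k0 : set 'rV[R]_N := [set k | analogous k k0].

Definition mass_linear k0 b : Prop :=
  exists (Rj : 'rV[R]_N) (C : R), forall k, chamber k0 k ->
    dot (center_of_mass (polyhedron k)) b = \sum_(j < N) Rj 0 j * k 0 j + C.

End polytopes.

(* The indices 1, ..., n+2 are shifted to 0, ..., n+1, and the vectors e_1,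
   ..., e_n to std_basis 0, ..., std_basis n.-1. *)
Section truncated_simplex.
Context {R : realType} (n : nat).

Definition std_basis (i : nat) : 'rV[R]_n := \row_(l < n) (l == i :> nat)%:R.

Definition conormal (j : 'I_n.+2) : 'rV[R]_n :=
  if (j < n)%N then - std_basis j
  else if j == n :> nat then \sum_(i < n) std_basis i
  else std_basis n.-1.

Definition support_numbers (tau lambda : R) : 'rV[R]_n.+2 :=
  \row_(j < n.+2) if (j < n)%N then 0 else if j == n :> nat then tau else lambda.

(* The condition i = n.-1 singles out the last coordinate, i.e. x_n. *)
Definition truncated_simplex (tau lambda : R) : set 'rV[R]_n :=
  [set x | [/\ \sum_(i < n) x 0 i <= tau, forall i, 0 <= x 0 i &
              forall i : 'I_n, i = n.-1 :> nat -> x 0 i <= lambda]].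

Lemma dot_std_basis (x : 'rV[R]_n) (i : 'I_n) : dot x (std_basis i) = x 0 i.
Proof.
rewrite /dot (bigD1 i)//= big1 ?addr0 => [|l li].
  by rewrite mxE eqxx mulr1.
by rewrite mxE val_eqE (negbTE li) mulr0.
Qed.

Lemma truncated_simplexE (tau lambda : R) : (0 < n)%N ->
  truncated_simplex tau lambda =
  polyhedron conormal (support_numbers tau lambda).
Proof.
move=> n0.
have dotN (x y : 'rV[R]_n) : dot x (- y) = - dot x y.
  by rewrite /dot -sumrN; apply: eq_bigr => i _; rewrite mxE mulrN.
have dots x : dot x (\sum_(i < n) std_basis i) = \sum_(i < n) x 0 i.
  rewrite -(eq_bigr _ (fun i _ => dot_std_basis x i)) /dot [RHS]exchange_big.
  by apply: eq_bigr => i _; rewrite summxE mulr_sumr.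
have nn : (n.-1 < n)%N by rewrite prednK.
have n2 : (n < n.+2)%N by [].
have n12 : (n.+1 < n.+2)%N by [].
apply/seteqP; split => x.
  move=> [xtau x0 xlambda] j; rewrite /conormal mxE.
  have [jn|nj] := ltnP j n.
    by rewrite dotN (dot_std_basis x (Ordinal jn)) oppr_le0.
  case: ifP => _; first by rewrite dots.
  by rewrite (dot_std_basis x (Ordinal nn)) xlambda.
move=> H; split => [|i|i iE].
- by have := H (Ordinal n2); rewrite /conormal mxE /= ltnn eqxx dots.
- have in2 : (i < n.+2)%N by rewrite (ltn_trans (ltn_ord i))// ltnW.
  have := H (Ordinal in2).
  by rewrite /conormal mxE /= ltn_ord dotN dot_std_basis oppr_le0.
- have := H (Ordinal n12); rewrite /conormal mxE /= ltnNge leqnSn/=.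
  by rewrite gtn_eqF// -iE dot_std_basis.
Qed.

End truncated_simplex.

(* Main.v *)
(* Up to translation, the polytope with simplex size t and truncation height u
   is the simplex of size t minus a corner simplex of size t - u, whose volume
   and first moments are explicit.  The coordinates of its center of mass are
   thus rational functions of t and u, and requiring <Cm, b> to be affine in
   (t, u) becomes, for each fixed t, a polynomial identity in t - u; its
   coefficients of degree 0 and 1 force R_(n+2) = 0, C = 0 and
   (n + 1) R_(n+1) = sum_i b_i.  Translating by (1, ..., 1) gives
   sum_i b_i = - sum_(j <= n) R_j + n R_(n+1) + R_(n+2), and the claim follows. *)
Require Import Defs.
From mathcomp Require Import all_boot all_order all_algebra.
From mathcomp Require Import all_classical all_reals all_analysis.
From mathcomp Require Import measurable_realfun ring lra.

Set Implicit Arguments.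
Unset Strict Implicit.
Unset Printing Implicit Defensive.

Import Order.TTheory GRing.Theory Num.Theory.
Import numFieldNormedType.Exports.

Local Open Scope classical_set_scope.
Local Open Scope ring_scope.

(** * Divided powers and the tools for integrating slice by slice *)

Lemma integral_deriv_poly (R : realType) (p : {poly R}) (a b : R) : a <= b ->
  (\int[lebesgue_measure]_(x in `[a, b]) (p^`().[x])%:E = (p.[b] - p.[a])%:E)%E.
Proof.
rewrite le_eqVlt => /predU1P[<-|ab].
  by rewrite set_itv1 integral_set1 subrr.
rewrite (@continuous_FTC2 _ _ (horner p))//.
- by apply: continuous_subspaceT => x; exact: continuous_horner.
- split.
  + by move=> x _; exact: derivable_horner.
  + by apply: cvg_at_right_filter; exact: continuous_horner.
  + by apply: cvg_at_left_filter; exact: continuous_horner.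
- by move=> x _; rewrite derivE.
Qed.

(** The divided power: for [x >= 0] it is the volume of the standard [m]-simplex of size [x].
    Integrating over slices then raises the index by one without producing constants. *)
Definition dpow (R : realType) (m : nat) (x : R) : R := x ^+ m / m`!%:R.

Lemma dpow0 (R : realType) m : @dpow R m.+1 0 = 0.
Proof. by rewrite /dpow expr0n mul0r. Qed.

Definition dpow_prim (R : realType) (m : nat) (c : R) : {poly R} :=
  - ((m.+1`!%:R^-1)%:P * (c%:P - 'X) ^+ m.+1).

Lemma horner_dpow_prim (R : realType) m (c x : R) :
  (dpow_prim m c).[x] = - dpow m.+1 (c - x).
Proof. by rewrite /dpow_prim /dpow !hornerE mulrC. Qed.

Lemma horner_deriv_dpow_prim (R : realType) m (c x : R) :
  (dpow_prim m c)^`().[x] = dpow m (c - x).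
Proof.
rewrite /dpow_prim /dpow derivN derivM derivC mul0r add0r deriv_exp derivB derivC.
rewrite derivX factS natrM hornerN hornerM hornerMn !hornerE /=.
have h1 : m.+1%:R != 0 :> R by rewrite pnatr_eq0.
have h2 : m`!%:R != 0 :> R by rewrite pnatr_eq0 -lt0n fact_gt0.
rewrite -mulr_natl; field; exact/andP.
Qed.

(** [lebesgue_rV R n.+1] is the push-forward of a product measure under [cons_rV], so Tonelli
    applies once [f] is extended by zero outside [D]. *)
Lemma integral_lebesgue_rVS (R : realType) n (D : set 'rV[R]_n.+1)
    (f : 'rV[R]_n.+1 -> \bar R) :
  measurable D -> measurable_fun D f -> (forall x, D x -> (0 <= f x)%E) ->
  (\int[lebesgue_rV R n.+1]_(z in D) f z =
   \int[lebesgue_measure]_x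
     \int[lebesgue_rV R n]_(y in [set y | D (cons_rV (x, y))])
       f (cons_rV (x, y)))%E.
Proof.
move=> mD mf f0.
rewrite integral_mkcond.
have mg : measurable_fun setT (f \_ D) by apply/(measurable_restrictT _ _).1.
have g0 x : (0 <= (f \_ D) x)%E.
  by rewrite patchE; case: ifPn => // /set_mem/f0.
have mcons : measurable_fun [set: measurableTypeR R * 'rV[R]_n] (@cons_rV R n).
  exact: (@measurable_cons_rV _ R n).
transitivity (\int[lebesgue_measure \x lebesgue_rV R n]_p
  (f \_ D) (cons_rV p))%E.
  exact: (ge0_integral_pushforward mcons).
rewrite fubini_tonelli1; [|exact: measurableT_comp|by move=> p; exact: g0].
by apply: eq_integral => x _; rewrite /fubini_F [RHS]integral_mkcond.
Qed.

(** * Volume and first moments of a simplex with an arbitrary corner *)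

Section corner_simplex.
Context {R : realType}.

Definition corner_simplex n (a : 'I_n -> R) (s : R) : set 'rV[R]_n :=
  [set x | (forall i, a i <= x 0 i) /\ \sum_(i < n) x 0 i <= s].

Lemma measurable_corner_simplex n (a : 'I_n -> R) s :
  measurable (corner_simplex a s).
Proof.
have -> : corner_simplex a s =
    [set x : 'rV[R]_n | forall i, [set` `[a i, +oo[] (x 0 i)] `&`
    (fun x : 'rV[R]_n => \sum_(i < n) x 0 i) @^-1` `]-oo, s].
  apply/seteqP; split => x /= [h1]; rewrite in_itv/= => h2; split=> // i.
    by rewrite in_itv/= andbT.
  by have := h1 i; rewrite in_itv/= andbT.
apply: measurableI.
  by apply: (@measurable_rV_box _ R n (fun i => [set` `[a i, +oo[])) => i.
rewrite -[X in measurable X]setTI; apply: measurable_sum => //.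
by move=> i; exact: (@measurable_rV_coord _ R n).
Qed.

Lemma corner_simplex_cons n (a : 'I_n.+1 -> R) (s x : R) (y : 'rV[R]_n) :
  corner_simplex a s (cons_rV (x, y)) <->
  a ord0 <= x /\ corner_simplex (fun i => a (lift ord0 i)) (s - x) y.
Proof.
rewrite /corner_simplex /= big_ord_recl cons_rV0 /=.
under eq_bigr do rewrite cons_rVS /=.
rewrite lerBrDl; split => [[h1 h2]|[h1 [h2 h3]]].
  split; first by have := h1 ord0; rewrite cons_rV0.
  by split => // i; have := h1 (lift ord0 i); rewrite cons_rVS.
split=> // i; case: (unliftP ord0 i) => [j ->|->].
  by rewrite cons_rVS /=.
by rewrite cons_rV0.
Qed.

Lemma corner_simplex_eq0 n (a : 'I_n -> R) (s : R) :
  s < \sum_(i < n) a i -> corner_simplex a s = set0.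
Proof.
move=> sa; rewrite -subset0 => x /= [h1 h2].
have : \sum_(i < n) a i <= \sum_(i < n) x 0 i by apply: ler_sum => i _.
by move=> /le_trans/(_ h2); rewrite leNgt sa.
Qed.

(** The slice at first coordinate [x] is a corner simplex of size [s - x]. It is empty for [x]
    outside the interval: on the left by the first bound, on the right because the other lower
    bounds add up to more than [s - x]. *)
Lemma integral_corner_simplexS n (a : 'I_n.+1 -> R) (s : R)
    (f : 'rV[R]_n.+1 -> \bar R) :
  measurable_fun (corner_simplex a s) f ->
  (forall x, corner_simplex a s x -> (0 <= f x)%E) ->
  (\int[lebesgue_rV R n.+1]_(z in corner_simplex a s) f z =
   \int[lebesgue_measure]_(x in
       `[a ord0, (s - \sum_(i < n) a (lift ord0 i))%R])
   \int[lebesgue_rV R n]_(y in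
       corner_simplex (fun i => a (lift ord0 i)) (s - x)%R)
      f (cons_rV (x, y)))%E.
Proof.
move=> mf f0.
rewrite (integral_lebesgue_rVS (measurable_corner_simplex _ _) mf f0).
rewrite [RHS]integral_mkcond; apply: eq_integral => x _.
rewrite patchE; case: ifPn => [|].
  rewrite inE/= in_itv/= => /andP[ax _].
  congr integral; apply/seteqP; split => y /=; rewrite corner_simplex_cons; tauto.
rewrite notin_setE/= in_itv/= => /negP; rewrite negb_and -!ltNge => xN.
rewrite (_ : [set y | _] = set0) ?integral_set0//.
rewrite -subset0 => y /=; rewrite corner_simplex_cons => -[ax].
case/orP: xN => [|h]; first by rewrite ltNge ax.
by rewrite corner_simplex_eq0// ltrBlDr -ltrBlDl.
Qed.

(** Induction on the dimension: the slice volumes [dpow n (s - t - x)] integrate to the next divided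
    power. In dimension 0 the Dirac mass 1 agrees with [dpow 0]. *)
Lemma corner_simplex_volume n (a : 'I_n -> R) (s : R) : \sum_(i < n) a i <= s ->
  lebesgue_rV R n (corner_simplex a s) = (dpow n (s - \sum_(i < n) a i))%:E.
Proof.
elim: n a s => [|n IH] a s.
  rewrite !big_ord0 => s0; rewrite /= diracE mem_set ?subr0 /dpow ?expr0 ?divr1//.
  by split; [case|rewrite big_ord0].
rewrite big_ord_recl; set t := \sum_(i < n) _ => ats.
rewrite -[LHS]mul1e -(integral_cst _ (measurable_corner_simplex a s)).
rewrite integral_corner_simplexS; [|exact: measurable_cst|by []].
transitivity (\int[lebesgue_measure]_(x in `[a ord0, (s - t)%R])
    ((dpow_prim n (s - t))^`().[x])%:E)%E.
  apply: eq_integral => x; rewrite inE /= in_itv/= -/t => /andP[_ xs].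
  rewrite (integral_cst _ (measurable_corner_simplex _ _)) mul1e.
  etransitivity; first by apply: IH; rewrite -/t; lra.
  by rewrite horner_deriv_dpow_prim; congr (dpow _ _)%:E; rewrite -/t; ring.
rewrite integral_deriv_poly; last lra.
rewrite !horner_dpow_prim subrr dpow0; congr _%:E.
rewrite oppr0 sub0r opprK; congr dpow; ring.
Qed.

(** Induction on the dimension, where the coordinate used for slicing needs its own computation. A
    nonnegative corner keeps the integrand nonnegative, as Tonelli requires. *)
Lemma corner_simplex_moment n (a : 'I_n -> R) (s : R) (i : 'I_n) :
  (forall i, 0 <= a i) -> \sum_(i < n) a i <= s ->
  (\int[lebesgue_rV R n]_(x in corner_simplex a s) (x 0%R i)%:E =
   (a i * dpow n (s - \sum_(i < n) a i) + dpow n.+1 (s - \sum_(i < n) a i))%:E)%E.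
Proof.
elim: n a s i => [|n IH] a s i a0; first by case: i.
rewrite big_ord_recl; set t := \sum_(i < n) _ => ats.
rewrite integral_corner_simplexS; last 2 first.
- apply/measurable_EFinP/measurable_funTS; exact: (@measurable_rV_coord _ R).
- by move=> x [h _]; rewrite lee_fin (le_trans _ (h i)).
rewrite -/t; case: (unliftP ord0 i) => [j ->|->].
  transitivity (\int[lebesgue_measure]_(x in `[a ord0, (s - t)%R])
    ((a (lift ord0 j) *: dpow_prim n (s - t) +
      dpow_prim n.+1 (s - t))^`().[x])%:E)%E.
    apply: eq_integral => x; rewrite inE /= in_itv/= -/t => /andP[_ xs].
    under eq_integral do rewrite cons_rVS.
    rewrite IH//; last by rewrite -/t; lra.
    rewrite derivD derivZ hornerD hornerZ !horner_deriv_dpow_prim -/t.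
    by rewrite (_ : s - x - t = s - t - x)//; ring.
  rewrite integral_deriv_poly; last lra.
  rewrite !hornerD !hornerZ !horner_dpow_prim subrr !dpow0.
  rewrite (_ : s - t - a ord0 = s - (a ord0 + t)); last ring.
  congr _%:E; ring.
(* Integration by parts: in the derivative of this polynomial, [dpow_prim n] cancels the derivative
   of [dpow_prim n.+1], which leaves [x] times the slice volume. *)
transitivity (\int[lebesgue_measure]_(x in `[a ord0, (s - t)%R])
  (('X * dpow_prim n (s - t) + dpow_prim n.+1 (s - t))^`().[x])%:E)%E.
  apply: eq_integral => x; rewrite inE /= in_itv/= -/t => /andP[xa xs].
  under eq_integral do rewrite cons_rV0.
  rewrite (integral_cst _ (measurable_corner_simplex _ _) x%:E).
  have /corner_simplex_volume vol : t <= s - x by lra.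
  rewrite [X in (_ * X)%E]vol.
  rewrite -EFinM derivD derivM derivX mul1r !hornerD hornerM hornerX.
  rewrite !horner_deriv_dpow_prim horner_dpow_prim -/t.
  rewrite (_ : s - x - t = s - t - x); last ring.
  congr _%:E; ring.
rewrite integral_deriv_poly; last lra.
rewrite !hornerD !hornerM !horner_dpow_prim hornerX subrr !dpow0.
rewrite (_ : s - t - a ord0 = s - (a ord0 + t)); last ring.
congr _%:E; rewrite hornerX; ring.
Qed.

End corner_simplex.

Lemma EFin_eq_addr (R : realDomainType) (x : \bar R) (p q : R) :
  (p%:E = x + q%:E)%E -> x = (p - q)%:E.
Proof. by case: x => //= r [->]; rewrite addrK. Qed.

(** * Truncation as the difference of two corner simplices *)

Section truncated_corner_simplex.
Context {R : realType} (n : nat).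
Variables (a : 'I_n -> R) (s : R) (l : 'I_n) (mu : R).
Hypothesis a_l : a l <= mu.

Definition truncated_corner_simplex : set 'rV[R]_n :=
  corner_simplex a s `&` [set x | x 0 l <= mu].

(** The corner of the simplex that is cut off, where the [l]-th coordinate starts at [mu]. *)
Definition raised_corner (i : 'I_n) : R := if i == l then mu else a i.

(** The cutting hyperplane, written as a box so that measurability and nullity come from the box
    lemmas. *)
Let N : set 'rV[R]_n :=
  [set x : 'rV[R]_n | forall i, (if i == l then [set mu] else setT) (x 0 i)].

Let mN_box i : measurable (if i == l then [set mu] else [set: R]).
Proof. by case: ifP. Qed.

Let mN : measurable N.
Proof. exact: (measurable_rV_box mN_box). Qed.

Let N0 : lebesgue_rV R n N = 0%E.
Proof.
by rewrite (lebesgue_rV_box mN_box) (bigD1 l)//= eqxx lebesgue_measure_set1 mul0e.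
Qed.

Let NE x : N x <-> x 0 l = mu.
Proof.
split=> [/(_ l)|xl i]; first by rewrite eqxx.
by case: ifP => // /eqP ->.
Qed.

Lemma measurable_truncated_corner_simplex : measurable truncated_corner_simplex.
Proof.
have -> : truncated_corner_simplex = corner_simplex a s `&`
    (fun x : 'rV[R]_n => x 0 l) @^-1` `]-oo, mu].
  by apply/seteqP; split => x [h xl]; split => //; move: xl; rewrite /= in_itv.
apply: measurableI; first exact: measurable_corner_simplex.
by rewrite -[X in measurable X]setTI; exact: (@measurable_rV_coord _ R n).
Qed.

Lemma sum_raised_corner :
  \sum_(i < n) raised_corner i = \sum_(i < n) a i + (mu - a l).
Proof.
rewrite (bigD1 l)//= [in RHS](bigD1 l)//= /raised_corner eqxx.
rewrite (eq_bigr a) => [|i /negbTE -> //]; ring.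
Qed.

(** The two simplices on the right meet only in the cutting hyperplane; removing it from the second
    makes the union disjoint. *)
Lemma corner_simplex_split : corner_simplex a s =
  truncated_corner_simplex `|` (corner_simplex raised_corner s `\` N).
Proof.
apply/seteqP; split => x /=; last first.
  case=> [[]//|[[h1 h2] _]]; split=> // i.
  by apply: le_trans (h1 i); rewrite /raised_corner; case: eqP => [->|].
move=> [h1 h2]; case: (leP (x 0 l) mu) => xl; [by left|right].
split; last by rewrite NE; apply/eqP; rewrite gt_eqF.
by split=> // i; rewrite /raised_corner; case: eqP => [->|//]; exact: ltW.
Qed.

Lemma integral_corner_simplex_split (f : 'rV[R]_n -> \bar R) :
  measurable_fun setT f -> (forall x, corner_simplex a s x -> (0 <= f x)%E) ->
  (\int[lebesgue_rV R n]_(x in corner_simplex a s) f x =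
   \int[lebesgue_rV R n]_(x in truncated_corner_simplex) f x +
   \int[lebesgue_rV R n]_(x in corner_simplex raised_corner s) f x)%E.
Proof.
move=> mf f0.
have mT := measurable_corner_simplex raised_corner s.
rewrite {1}corner_simplex_split ge0_integral_setU.
(* The hyperplane [N] is null, so putting it back does not change the integral. *)
- congr (_ + _)%E; apply/esym/ge0_negligible_integral => //.
  + exact: measurable_funTS.
  + move=> x [h1 h2]; apply: f0; split=> // i.
    by apply: le_trans (h1 i); rewrite /raised_corner; case: eqP => [->|].
- exact: measurable_truncated_corner_simplex.
- exact: measurableD.
- exact: measurable_funTS.
- by rewrite -corner_simplex_split.
- apply/disj_setPS => x [[_ /= xl] [[h _] xN]]; apply/xN/NE/le_anti.
  by rewrite xl/=; have := h l; rewrite /raised_corner eqxx.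
Qed.

Hypothesis a0 : forall i, 0 <= a i.
Hypothesis a_s : \sum_(i < n) a i + (mu - a l) <= s.

(** [t] and [u] are the sizes of the whole simplex and of the removed one, measured from their
    corners; [a_s] says that [u] is nonnegative. *)
Let t := s - \sum_(i < n) a i.
Let u := t - (mu - a l).

Let sum_a_le : \sum_(i < n) a i <= s.
Proof. by apply: le_trans a_s; rewrite lerDl subr_ge0. Qed.

Lemma truncated_corner_simplex_volume :
  lebesgue_rV R n truncated_corner_simplex = (dpow n t - dpow n u)%:E.
Proof.
have := integral_corner_simplex_split (@measurable_cst _ _ _ _ _ 1%E)
  (fun _ _ => lee01).
rewrite !integral_cst; [|exact: measurable_corner_simplex
  |exact: measurable_truncated_corner_simplex|exact: measurable_corner_simplex].
have /corner_simplex_volume va := sum_a_le.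
have /corner_simplex_volume vr : \sum_(i < n) raised_corner i <= s.
  by rewrite sum_raised_corner.
rewrite !mul1e [X in X = _]va [X in (_ + X)%E]vr => /EFin_eq_addr ->.
by rewrite sum_raised_corner opprD addrA.
Qed.

Lemma truncated_corner_simplex_moment (i : 'I_n) :
  (\int[lebesgue_rV R n]_(x in truncated_corner_simplex) (x 0%R i)%:E =
   (a i * dpow n t + dpow n.+1 t -
    (raised_corner i * dpow n u + dpow n.+1 u))%:E)%E.
Proof.
have mi : measurable_fun [set: 'rV[R]_n] (fun x => (x 0 i)%:E).
  by apply/measurable_EFinP; exact: (@measurable_rV_coord _ R n).
have := integral_corner_simplex_split mi.
rewrite !corner_simplex_moment//; last 2 first.
- move=> j; rewrite /raised_corner; case: eqP => [_|_].
    exact: le_trans (a0 l) a_l.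
  exact: a0.
- by rewrite sum_raised_corner.
rewrite sum_raised_corner opprD addrA => H.
apply/EFin_eq_addr/H => x [h _].
by rewrite lee_fin; exact: le_trans (h i).
Qed.

End truncated_corner_simplex.

(** * Translated truncated simplices in terms of conormals *)

Section shifted_truncated_simplex.
Context {R : realType} (n : nat) (l : 'I_n).
Hypothesis lE : l = n.-1 :> nat.

(** Here [insub (val j)] tests whether [j] is among the first [n] indices and, if so, returns it as
    a coordinate index. *)
Lemma dot_conormal (x : 'rV[R]_n) (j : 'I_n.+2) :
  dot x (conormal j) =
  if insub (val j) is Some i then - x 0 i
  else if j == n :> nat then \sum_(i < n) x 0 i else x 0 l.
Proof.
rewrite /conormal; case: insubP => [i jn ij|/negbTE ->].
  rewrite jn -ij -dot_std_basis /dot -sumrN.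
  by apply: eq_bigr => k _; rewrite !mxE mulrN.
case: ifP => _; last by rewrite -lE dot_std_basis.
rewrite -(eq_bigr _ (fun i _ => dot_std_basis x i)) /dot [RHS]exchange_big.
by apply: eq_bigr => i _; rewrite summxE mulr_sumr.
Qed.

(* Support numbers of Delta(0, ..., 0, tau, lambda) translated by (r, ..., r). *)
Definition shifted_support_numbers (r tau lambda : R) : 'rV[R]_n.+2 :=
  \row_(j < n.+2) if (j < n)%N then - r
    else if j == n :> nat then tau + n%:R * r else lambda + r.

Lemma shifted_support_numbers0 tau lambda :
  shifted_support_numbers 0 tau lambda = support_numbers n tau lambda.
Proof. by apply/rowP => j; rewrite !mxE mulr0 !addr0 oppr0. Qed.

(** The polyhedron is where all slacks are nonnegative, and a facet is where one of them vanishes as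
    well; positive rescaling of the slacks preserves both conditions. *)
Definition slack (k : 'rV[R]_n.+2) (j : 'I_n.+2) (x : 'rV[R]_n) : R :=
  k 0 j - dot x (conormal j).

Lemma slack_shifted r tau lambda x j :
  slack (shifted_support_numbers r tau lambda) j x =
  if insub (val j) is Some i then x 0 i - r
  else if j == n :> nat then tau - \sum_(i < n) (x 0 i - r)
  else lambda - (x 0 l - r).
Proof.
rewrite /slack dot_conormal mxE; case: insubP => [i -> _|/negbTE ->]; first ring.
case: ifP => _; last ring.
by rewrite sumrB sumr_const card_ord -mulr_natl; ring.
Qed.

Lemma polyhedron_shifted r tau lambda :
  polyhedron (@conormal R n) (shifted_support_numbers r tau lambda) =
  truncated_corner_simplex (fun=> r) (tau + n%:R * r) l (lambda + r).
Proof.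
have E x j : (dot x (conormal j) <= shifted_support_numbers r tau lambda 0 j) =
    (0 <= slack (shifted_support_numbers r tau lambda) j x) by rewrite subr_ge0.
have nl (m : nat) : (n <= m)%N -> insub m = None :> option 'I_n.
  by move=> nm; rewrite insubN// -leqNgt.
have sumE x : \sum_(i < n) (x 0 i - r) = \sum_(i < n) x 0 i - n%:R * r :> R.
  by rewrite sumrB sumr_const card_ord mulr_natl.
apply/seteqP; split => x.
  move=> H; split; first split=> [i|].
  - have in2 : (i < n.+2)%N by rewrite (ltn_trans (ltn_ord i))// ltnW.
    have := H (Ordinal in2); rewrite E slack_shifted /= (valK i); lra.
  - have n2 : (n < n.+2)%N by [].
    have := H (Ordinal n2); rewrite E slack_shifted /= nl// eqxx sumE; lra.
  - have n12 : (n.+1 < n.+2)%N by [].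
    have := H (Ordinal n12); rewrite E slack_shifted /= nl// gtn_eqF//; lra.
move=> [[h1 h2] /= h3] j; rewrite E slack_shifted.
case: insubP => [i _ _|_]; first by have := h1 i; lra.
by case: ifP => _; rewrite ?sumE; lra.
Qed.

(** * Matching facet patterns: the translated polytopes lie in the chamber *)

Section analogy.
Variables r tau lambda r' tau' lambda' : R.
Hypotheses (lambda_gt0 : 0 < lambda) (lambda_tau : lambda < tau).
Hypotheses (lambda'_gt0 : 0 < lambda') (lambda'_tau' : lambda' < tau').

Let k := shifted_support_numbers r tau lambda.
Let k' := shifted_support_numbers r' tau' lambda'.

Let height_ratio := lambda' / lambda.
Let section_ratio (x : 'rV[R]_n) :=
  (tau' - height_ratio * (x 0 l - r)) / (tau - (x 0 l - r)).

(* Rescales the height of x above the bottom facet, and the horizontal section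
   through x; it multiplies every slack by a positive factor, so it sends each
   facet into the corresponding one. *)
Definition analogy (x : 'rV[R]_n) : 'rV[R]_n :=
  \row_i (r' + (if i == l then height_ratio else section_ratio x) * (x 0 i - r)).

(** On the polytope the height [x 0 l - r] is at most [lambda < tau], and its rescaling is at most
    [lambda' < tau']; hence [section_ratio x] is positive. *)
Lemma slack_analogy x : polyhedron (@conormal R n) k x ->
  forall j, exists2 c : R, 0 < c & slack k' j (analogy x) = c * slack k j x.
Proof.
rewrite polyhedron_shifted => -[[_ _] /= xl] j.
have hr0 : 0 < height_ratio by rewrite divr_gt0.
have yl : x 0 l - r <= lambda by rewrite lerBlDr.
have d0 : 0 < tau - (x 0 l - r) by rewrite subr_gt0 (le_lt_trans yl).
have n0 : 0 < tau' - height_ratio * (x 0 l - r).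
  have : height_ratio * (x 0 l - r) <= height_ratio * lambda.
    by rewrite ler_pM2l.
  rewrite [X in _ <= X]divfK ?gt_eqF// => /le_lt_trans/(_ lambda'_tau').
  by rewrite subr_gt0.
have sr0 : 0 < section_ratio x by rewrite divr_gt0.
have aE i : analogy x 0 i - r' =
    (if i == l then height_ratio else section_ratio x) * (x 0 i - r).
  by rewrite mxE addrC addKr.
rewrite !slack_shifted; case: insubP => [i _ _|_].
  exists (if i == l then height_ratio else section_ratio x); last exact: aE.
  by case: ifP.
case: ifP => _.
  exists (section_ratio x) => //.
  have -> : \sum_(i < n) (analogy x 0 i - r') = height_ratio * (x 0 l - r) +
      section_ratio x * \sum_(i < n | i != l) (x 0 i - r).
    rewrite (bigD1 l)//= aE eqxx mulr_sumr; congr (_ + _).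
    by apply: eq_bigr => i /negbTE il; rewrite aE il.
  rewrite [in RHS](bigD1 l)//=.
  (* This identity dictates the choice of [section_ratio]: the slack of the slanted facet is scaled
     by the same factor as the horizontal coordinates. *)
  have srE : section_ratio x * (tau - (x 0 l - r)) =
      tau' - height_ratio * (x 0 l - r) by rewrite divfK ?gt_eqF.
  set S := \sum_(i < n | _) _.
  by rewrite opprD addrA -srE; ring.
exists height_ratio => //; rewrite aE eqxx [RHS]mulrBr; congr (_ - _).
by rewrite /height_ratio divfK ?gt_eqF.
Qed.

Lemma facet_analogy x j : facet (@conormal R n) k j x ->
  facet (@conormal R n) k' j (analogy x).
Proof.
move=> [kx /= xj]; split => /=.
  move=> i; have [c c0] := slack_analogy kx i.
  rewrite /slack => h; rewrite -subr_ge0 h mulr_ge0 ?(ltW c0)// subr_ge0.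
  exact: kx.
have [c c0] := slack_analogy kx j.
by rewrite {2}/slack xj subrr mulr0 => /eqP; rewrite subr_eq0 => /eqP.
Qed.

End analogy.

(** The analogies in the two directions carry a common point of facets of either polytope to a
    common point of the corresponding facets of the other. *)
Lemma chamber_shifted (r tau lambda tau0 lambda0 : R) :
  0 < lambda < tau -> 0 < lambda0 < tau0 ->
  chamber (@conormal R n) (support_numbers n tau0 lambda0)
    (shifted_support_numbers r tau lambda).
Proof.
move=> /andP[l0 lt] /andP[l00 lt0] J; rewrite -shifted_support_numbers0.
split=> -[x xJ].
  by exists (analogy r tau lambda 0 tau0 lambda0 x) => j /xJ; exact: facet_analogy.
by exists (analogy 0 tau0 lambda0 r tau lambda x) => j /xJ; exact: facet_analogy.
Qed.

(** Multiplying by the volume [V] clears the denominators. The term in [b 0 l] arises because the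
    removed corner is raised by [lambda] in that coordinate only. *)
Lemma dot_center_of_mass_shifted (b : 'rV[R]_n) (r tau lambda : R) :
  0 <= r -> 0 < lambda < tau ->
  let V := dpow n tau - dpow n (tau - lambda) in
  V != 0 /\
  dot (center_of_mass (polyhedron (@conormal R n)
        (shifted_support_numbers r tau lambda))) b * V =
  (\sum_(i < n) b 0 i) * (r * V + (dpow n.+1 tau - dpow n.+1 (tau - lambda)))
  - b 0 l * (lambda * dpow n (tau - lambda)).
Proof.
move=> r0 /andP[l0 lt] V.
have n_gt0 : (0 < n)%N by case: (n) l => // -[].
have V0 : V != 0.
  rewrite subr_eq0 gt_eqF// /dpow ltr_pM2r ?invr_gt0 ?ltr0n ?fact_gt0//.
  by rewrite ltrXn2r -?lt0n// ?nnegrE; lra.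
split=> //.
have sum_r : \sum_(i < n) r = n%:R * r by rewrite sumr_const card_ord mulr_natl.
rewrite polyhedron_shifted; set D := truncated_corner_simplex _ _ _ _.
have lr : r <= lambda + r by lra.
have rs : \sum_(i < n) r + (lambda + r - r) <= tau + n%:R * r by rewrite sum_r; lra.
have tE : tau + n%:R * r - \sum_(i < n) r = tau by rewrite sum_r; ring.
have uE : tau - (lambda + r - r) = tau - lambda by ring.
have volD : lebesgue_rV R n D = V%:E.
  by rewrite (truncated_corner_simplex_volume lr rs) tE uE.
have momD i : \int[lebesgue_rV R n]_(x in D) x 0 i =
    r * V + (dpow n.+1 tau - dpow n.+1 (tau - lambda)) -
    (i == l)%:R * (lambda * dpow n (tau - lambda)).
  rewrite /Rintegral (truncated_corner_simplex_moment lr (fun=> r0) rs) tE uE /=.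
  rewrite /raised_corner /V; case: eqP => _ /=; ring.
rewrite /dot mulr_suml; under eq_bigr => i _.
  rewrite mxE volD momD /= mulrAC divfK// mulrC mulrBr. over.
rewrite sumrB mulr_suml; congr (_ - _).
rewrite (bigD1 l)//= eqxx mul1r big1 ?addr0// => i /negbTE ->.
by rewrite mul0r mulr0.
Qed.

Lemma sum_shifted (Rj : 'rV[R]_n.+2) (r tau lambda : R) :
  \sum_(j < n.+2) Rj 0 j * shifted_support_numbers r tau lambda 0 j =
  - r * (\sum_(j < n) Rj 0 (widen_ord (leqnSn _) (widen_ord (leqnSn _) j))) +
  Rj 0 (widen_ord (leqnSn _) ord_max) * (tau + n%:R * r) +
  Rj 0 ord_max * (lambda + r).
Proof.
rewrite !big_ord_recr /= !mxE /= ltnn eqxx ltnNge leqnSn /= gtn_eqF//.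
congr (_ + _ + _); rewrite mulr_sumr; apply: eq_bigr => i _.
by rewrite mxE /= ltn_ord mulrC.
Qed.

End shifted_truncated_simplex.

(** * Polynomial identities on an interval *)

(** The points [t/2, t/3, ...] provide [size p] distinct roots, more than the degree of a nonzero
    [p] allows. Starting at [t/2] keeps them strictly below [t]. *)
Lemma poly_eq0_itv (R : realFieldType) (p : {poly R}) (t : R) : 0 < t ->
  (forall x, 0 < x < t -> p.[x] = 0) -> p = 0.
Proof.
move=> t0 p0; pose rs := [seq t / i.+2%:R | i <- iota 0 (size p)].
apply: (@roots_geq_poly_eq0 _ p rs).
- apply/allP => _ /mapP[i _ ->]; apply/rootP/p0.
  by rewrite divr_gt0 ?ltr0n//= ltr_pdivrMr ?ltr0n// ltr_pMr// ltr1n.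
- rewrite map_inj_uniq ?iota_uniq// => i j /(mulfI (lt0r_neq0 t0)).
  by move=> /invr_inj/eqP; rewrite eqr_nat => /eqP[].
- by rewrite size_map size_iota.
Qed.

(** Only the two lowest coefficients are read off, so everything divisible by [x ^+ 2] is collected
    in [q]. *)
Lemma low_coefs_eq0 (R : realFieldType) (c0 c1 t : R) (q : {poly R}) : 0 < t ->
  (forall x, 0 < x < t -> c0 + c1 * x + x ^+ 2 * q.[x] = 0) -> c0 = 0 /\ c1 = 0.
Proof.
move=> t0 H.
have p0 : c0%:P + c1 *: 'X + q * 'X^2 = 0.
  by apply: (poly_eq0_itv t0) => x /H <-; rewrite !hornerE /=; ring.
have := congr1 (fun p : {poly R} => p`_0) p0.
have := congr1 (fun p : {poly R} => p`_1) p0.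
rewrite !coef0 !coefD !coefC !coefZ !coefX !coefMXn /=.
by rewrite mulr0 mulr1 !add0r !addr0 => -> ->.
Qed.

(** * Mass linearity evaluated on the translated truncated simplices *)

Theorem proposition21 (R : realType) (n : nat) (tau lambda : R)
    (b : 'rV[R]_n) (Rj : 'rV[R]_n.+2) (C : R)
    (hn : (2 <= n)%N) (htau : 0 < tau) (hlambda : 0 < lambda)
    (htl : 0 < tau - lambda)
    (hml : mass_linear (@conormal R n) (support_numbers n tau lambda) b)
    (hRC : forall k : 'rV[R]_n.+2,
      chamber (@conormal R n) (support_numbers n tau lambda) k ->
      dot (center_of_mass (polyhedron (@conormal R n) k)) b
      = \sum_(j < n.+2) Rj 0 j * k 0 j + C) :
  \sum_(j < n.+2) Rj 0 j = 0.
Proof.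
(* Because [n >= 2], [x ^+ n] is divisible by [x ^+ 2]; the removed corner of size [x] will thus not
   affect the coefficients of degree 0 and 1. *)
have [m nE] : exists m, n = m.+2 by exists n.-2; case: (n) hn => [|[|]].
have ln : (n.-1 < n)%N by rewrite nE.
pose l := Ordinal ln; have lE : l = n.-1 :> nat by [].
have lt0 : 0 < lambda < tau by rewrite hlambda -subr_gt0.
(* [A] collects the coefficients of the coordinate facets, while [P] and [Q] belong to the slanted
   facet and the truncating facet. *)
pose A := \sum_(j < n) Rj 0 (widen_ord (leqnSn _) (widen_ord (leqnSn _) j)).
pose P : R := Rj 0 (widen_ord (leqnSn _) ord_max).
pose Q : R := Rj 0 ord_max.
pose S := \sum_(i < n) b 0 i.
pose V t u : R := dpow n t - dpow n (t - u).
have key (r t u : R) : 0 <= r -> 0 < u < t -> V t u != 0 /\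
    (- r * A + P * (t + n%:R * r) + Q * (u + r) + C) * V t u =
    S * (r * V t u + (dpow n.+1 t - dpow n.+1 (t - u))) -
    b 0 l * (u * dpow n (t - u)).
  move=> r0 ut; have [V0 <-] := dot_center_of_mass_shifted lE b r0 ut.
  split=> //; rewrite -sum_shifted -hRC//.
  exact: (chamber_shifted lE).
(* Subtracting the identities for [r = 0] and [r = 1] at the same size and height isolates the
   effect of the translation; [t = 2], [u = 1] is just one admissible choice. *)
have S_eq : S = - A + n%:R * P + Q.
  have ut : 0 < (1 : R) < (2 : R) by rewrite ltr01 ltr1n.
  have [V0 H0] := key 0 2 1 (lexx _) ut.
  have [_ H1] := key 1 2 1 ler01 ut.
  apply/(mulIf V0); move: (V 2 1) H0 H1 => v; lra.
have coefs (t : R) : 0 < t -> S * t = n.+1%:R * (P * t + C) /\ Q = 0.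
  move=> t0.
  have f0 : dpow n t != 0.
    by rewrite /dpow mulf_neq0 ?expf_neq0 ?gt_eqF ?invr_gt0 ?ltr0n ?fact_gt0.
  have dpowS x : n.+1%:R * dpow n.+1 x = x * dpow n x :> R.
    have n1 : n.+1%:R != 0 :> R by rewrite pnatr_eq0.
    have nf : n`!%:R != 0 :> R by rewrite pnatr_eq0 -lt0n fact_gt0.
    by rewrite /dpow factS natrM exprS; field; apply/andP.
  (* With [x = t - u], this is the part of the identity of degree at least 2 in [x], divided by
     [x ^+ 2]. *)
  pose q : {poly R} := (- S / n.+1`!%:R) *: 'X^(m.+1) +
    ((P * t + Q * t + C - b 0 l * t) / n`!%:R)%:P * 'X^m +
    ((b 0 l - Q) / n`!%:R) *: 'X^(m.+1).
  have [|c0 c1] := @low_coefs_eq0 R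
    (S * dpow n.+1 t - (P * t + Q * t + C) * dpow n t) (Q * dpow n t) t q t0.
    move=> x /andP[x0 xt].
    have ut : 0 < t - x < t by apply/andP; split; lra.
    have [_] := key 0 t (t - x) (lexx _) ut.
    have tx : t - (t - x) = x by ring.
    have xn : x ^+ n = x ^+ 2 * x ^+ m by rewrite nE -exprD.
    rewrite /V tx /q /dpow !hornerE /= => /esym/eqP.
    rewrite -subr_eq0 => /eqP <-; rewrite [x ^+ n.+1]exprS xn [x ^+ m.+1]exprS.
    move: (n`!%:R^-1) (n.+1`!%:R^-1) => f g; ring.
  have Q0 : Q = 0 by move/eqP: c1; rewrite mulf_eq0 (negbTE f0) orbF => /eqP.
  (* Multiplying the constant coefficient by [n.+1] turns [dpow n.+1 t] into [t * dpow n t], after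
     which the nonzero factor [dpow n t] cancels. *)
  split=> //; apply/(mulIf f0)/eqP; rewrite -subr_eq0.
  apply/eqP; transitivity (n.+1%:R *
    (S * dpow n.+1 t - (P * t + Q * t + C) * dpow n t)); last by rewrite c0 mulr0.
  rewrite Q0 [in RHS]mulrBr [in RHS]mulrCA dpowS; ring.
(* The values [t = 1] and [t = 2] force [(n + 1) C = 0], hence [S = (n + 1) P]. Comparison with
   [S_eq] and [Q = 0] leaves [A + P = 0]. *)
have [e1 Q0] := coefs 1 ltr01.
have [e2 _] := coefs 2 (ltr0n _ 2).
rewrite -natr1 in e1 e2.
rewrite !big_ord_recr /= -/A -/P -/Q; lra.
Qed.
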